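(* Let $G,H$ be compact Lie groups, $X$ a compact $G$-ANR and $Y$ a compact $H$-ANR. Consider $X\times Y$ as a $G\times H$-space via $(g,h)(x,y)=(gx,hy)$. Then $$TC_{G\times H}(X\times Y)\leqslant TC_G(X)+TC_H(Y)-1.$$ Moreover, if $\daleth(X)\subseteq X\times X$ is a $G\times G$-cofibration and $\daleth(Y)\subseteq Y\times Y$ is an $H\times H$-cofibration, then $$TC^{G\times H}(X\times Y)\leqslant TC^G(X)+TC^H(Y)-1.$$
   Context: For a compact Lie group $K$, a $K$-ANR is a metrizable $K$-space which is an equivariant neighbourhood retract of every metrizable $K$-space containing it as a closed $K$-invariant subspace. A closed $K$-invariant inclusion $A\subseteq Z$ is a $K$-cofibration if it has the $K$-equivariant homotopy extension property for maps into all $K$-spaces. For a $K$-space $Z$, $TC_K(Z)$ is the least $n$ such that $Z\times Z$ (with diagonal $K$-action) is covered by $n$ open $K$-invariant sets $U_i$, each admitting a $K$-map $s_i\colon U_i\to PZ$ with $\pi\circ s_i$ equal to the inclusion $U_i\subseteq Z\times Z$; here $PZ$ is the space of paths $[0,1]\to Z$ with pointwise $K$-action and $\pi(\gamma)=(\gamma(0),\gamma(1))$. For a $K$-space $Z$ and closed $K$-invariant $A\subseteq Z$, an open $K$-invariant $U\subseteq Z$ is $K$-compressible into $A$ if the inclusion $U\subseteq Z$ is $K$-homotopic to a $K$-map $c\colon U\to Z$ with $c(U)\subseteq A$; ${}_A\mathrm{cat}_K(Z)$ is the least $n$ such that $Z$ is covered by $n$ open $K$-invariant subsets each $K$-compressible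 into $A$. For a $K$-space $Z$, let $K\times K$ act on $Z\times Z$ by $(k_1,k_2)(z_1,z_2)=(k_1z_1,k_2z_2)$, let $\Delta(Z)$ be the diagonal, $\daleth(Z):=(K\times K)\cdot\Delta(Z)$, and $TC^K(Z):={}_{\daleth(Z)}\mathrm{cat}_{K\times K}(Z\times Z)$. All these numbers are $\infty$ if no such $n$ exists. *)

(* Defs.v *)
From HB Require Import structures.
From mathcomp Require Import all_boot all_order all_algebra.
From mathcomp Require Import all_classical all_reals all_analysis.
Import Order.TTheory GRing.Theory Num.Theory.
Import numFieldNormedType.Exports.

Set Implicit Arguments.
Unset Strict Implicit.
Unset Printing Implicit Defensive.

Local Open Scope classical_set_scope.
Local Open Scope ring_scope.

HB.mixin Record isTopologicalGroup G & Group G & Topological G := {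
  mulg_continuous : continuous (fun x : G * G => (x.1 * x.2)%g) ;
  invg_continuous : continuous (fun x : G => (x^-1)%g)
}.

#[short(type="topologicalGroupType")]
HB.structure Definition TopologicalGroup :=
  {G of Group G & Topological G & isTopologicalGroup G}.

Lemma cvg_fun_pair (T U V : topologicalType) (f : T -> U) (g : T -> V) (x : T) :
  {for x, continuous f} -> {for x, continuous g} ->
  {for x, continuous (fun y => (f y, g y))}.
Proof. by move=> cf cg; apply: cvg_pair. Qed.

Lemma continuous_pair (T U V : topologicalType) (f : T -> U) (g : T -> V) :
  continuous f -> continuous g -> continuous (fun y => (f y, g y)).
Proof. by move=> cf cg x; apply: cvg_fun_pair; [exact: cf|exact: cg]. Qed.

Lemma continuous_comp2 (T U V : topologicalType) (f : T -> U) (g : U -> V) :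
  continuous f -> continuous g -> continuous (fun x => g (f x)).
Proof. by move=> cf cg x; apply: continuous_comp; [exact: cf|exact: cg]. Qed.

Lemma continuous_fst (U V : topologicalType) : continuous (@fst U V).
Proof. by move=> x; apply: cvg_fst. Qed.

Lemma continuous_snd (U V : topologicalType) : continuous (@snd U V).
Proof. by move=> x; apply: cvg_snd. Qed.

Section product_group.
Variables G H : topologicalGroupType.

Lemma prod_mulg_continuous :
  continuous (fun x : (G * H) * (G * H) => (x.1 * x.2)%g).
Proof.
apply: continuous_pair.
- apply: (continuous_comp2 (f := fun x : (G * H) * (G * H) => (x.1.1, x.2.1))
    (g := fun y : G * G => (y.1 * y.2)%g)); last exact: mulg_continuous.
  apply: continuous_pair.
  + exact: (continuous_comp2 (@continuous_fst _ _) (@continuous_fst _ _)).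
  + exact: (continuous_comp2 (@continuous_snd _ _) (@continuous_fst _ _)).
- apply: (continuous_comp2 (f := fun x : (G * H) * (G * H) => (x.1.2, x.2.2))
    (g := fun y : H * H => (y.1 * y.2)%g)); last exact: mulg_continuous.
  apply: continuous_pair.
  + exact: (continuous_comp2 (@continuous_fst _ _) (@continuous_snd _ _)).
  + exact: (continuous_comp2 (@continuous_snd _ _) (@continuous_snd _ _)).
Qed.

Lemma prod_invg_continuous : continuous (fun x : G * H => (x^-1)%g).
Proof.
apply: continuous_pair.
- exact: (continuous_comp2 (@continuous_fst _ _) (@invg_continuous G)).
- exact: (continuous_comp2 (@continuous_snd _ _) (@invg_continuous H)).
Qed.

HB.instance Definition _ := isTopologicalGroup.Build (G * H)%type
  prod_mulg_continuous prod_invg_continuous.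
End product_group.

(* On an open subset of a finite-dimensional space this is the usual class
   C^k: all iterated directional derivatives up to order k exist and are
   continuous. *)
Fixpoint Ck_on (R : realType) (V W : normedModType R) (k : nat)
    (U : set V) (f : V -> W) : Prop :=
  (forall x, U x -> {for x, continuous f}) /\
  (if k is k'.+1 then
     forall v, (forall x, U x -> derivable f x v) /\
               Ck_on k' U (fun x => 'D_v f x)
   else True).

Definition smooth_on (R : realType) (V W : normedModType R)
    (U : set V) (f : V -> W) : Prop := forall k, Ck_on k U f.

Record chart (R : realType) (M : topologicalType) (n : nat) := Chart {
  chart_dom : set M ;
  chart_map : M -> 'rV[R]_n ;
  chart_inv : 'rV[R]_n -> M ;
  chart_dom_open : open chart_dom ;
  chart_img_open : open (chart_map @` chart_dom) ;
  chart_mapK : forall x, chart_dom x -> chart_inv (chart_map x) = x ;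
  chart_map_continuous : {within chart_dom, continuous chart_map} ;
  chart_inv_continuous :
    {within chart_map @` chart_dom, continuous chart_inv}
}.

Definition chart_img (R : realType) (M : topologicalType) (n : nat)
  (a : chart R M n) : set 'rV[R]_n := chart_map a @` chart_dom a.

Definition smooth_atlas (R : realType) (M : topologicalType) (n : nat)
    (A : set (chart R M n)) : Prop :=
  (forall x, exists2 a, A a & chart_dom a x) /\
  (forall a b, A a -> A b ->
     smooth_on (chart_map a @` (chart_dom a `&` chart_dom b))
               (fun u => chart_map b (chart_inv a u))).

Definition smooth_mulg (R : realType) (G : topologicalGroupType) (n : nat)
    (A : set (chart R G n)) : Prop :=
  forall a b c, A a -> A b -> A c ->
    smooth_on
      [set uv : 'rV[R]_n * 'rV[R]_n |
        [/\ chart_img a uv.1, chart_img b uv.2 &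
            chart_dom c (chart_inv a uv.1 * chart_inv b uv.2)%g]]
      (fun uv => chart_map c (chart_inv a uv.1 * chart_inv b uv.2)%g).

Definition smooth_invg (R : realType) (G : topologicalGroupType) (n : nat)
    (A : set (chart R G n)) : Prop :=
  forall a b, A a -> A b ->
    smooth_on
      [set u | chart_img a u /\ chart_dom b ((chart_inv a u)^-1)%g]
      (fun u => chart_map b ((chart_inv a u)^-1)%g).

Definition lie_group (R : realType) (G : topologicalGroupType) : Prop :=
  [/\ hausdorff_space G, @second_countable G &
      exists n (A : set (chart R G n)),
        [/\ smooth_atlas A, smooth_mulg A & smooth_invg A]].

Definition compact_lie_group (R : realType) (G : topologicalGroupType) : Prop :=
  lie_group R G /\ compact [set: G].

Record gSpace (K : topologicalGroupType) := GSpace {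
  gcarrier :> topologicalType ;
  gact : K -> gcarrier -> gcarrier ;
  gact1 : forall z, gact 1%g z = z ;
  gactM : forall k l z, gact (k * l)%g z = gact k (gact l z) ;
  gact_continuous : continuous (fun kz : K * gcarrier => gact kz.1 kz.2)
}.
Arguments gact {K g} k z.

Section k_maps.
Variables (K : topologicalGroupType) (Z W : gSpace K).

Definition ginvariant (U : set Z) : Prop := forall k z, U z -> U (gact k z).

Definition gmap (f : Z -> W) : Prop :=
  continuous f /\ forall k z, f (gact k z) = gact k (f z).

(* K-maps defined on an invariant subset U only; the values of f outside U
   are irrelevant. *)
Definition gmap_on (U : set Z) (f : Z -> W) : Prop :=
  {within U, continuous f} /\
  forall k z, U z -> f (gact k z) = gact k (f z).

End k_maps.

Section product_space.
Variables (G H : topologicalGroupType) (X : gSpace G) (Y : gSpace H).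

Definition prod_act (k : G * H) (z : X * Y) : X * Y :=
  (gact k.1 z.1, gact k.2 z.2).

Lemma prod_act1 z : prod_act 1%g z = z.
Proof. by case: z => x y; rewrite /prod_act /= !gact1. Qed.

Lemma prod_actM k l z : prod_act (k * l)%g z = prod_act k (prod_act l z).
Proof. by case: z => x y; rewrite /prod_act /= !gactM. Qed.

Lemma prod_act_continuous :
  continuous (fun kz : (G * H) * (X * Y) => prod_act kz.1 kz.2).
Proof.
apply: continuous_pair.
- apply: (continuous_comp2 (f := fun x : (G * H) * (X * Y) => (x.1.1, x.2.1))
    (g := fun y : G * X => gact y.1 y.2)); last exact: gact_continuous.
  apply: continuous_pair.
  + exact: (continuous_comp2 (@continuous_fst _ _) (@continuous_fst _ _)).
  + exact: (continuous_comp2 (@continuous_snd _ _) (@continuous_fst _ _)).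
- apply: (continuous_comp2 (f := fun x : (G * H) * (X * Y) => (x.1.2, x.2.2))
    (g := fun y : H * Y => gact y.1 y.2)); last exact: gact_continuous.
  apply: continuous_pair.
  + exact: (continuous_comp2 (@continuous_fst _ _) (@continuous_snd _ _)).
  + exact: (continuous_comp2 (@continuous_snd _ _) (@continuous_snd _ _)).
Qed.

Definition prod_gSpace : gSpace (G * H)%type :=
  @GSpace (G * H)%type (X * Y)%type _ prod_act1 prod_actM prod_act_continuous.

End product_space.

Section diagonal_square.
Variables (K : topologicalGroupType) (Z : gSpace K).

Definition diag_act (k : K) (z : Z * Z) : Z * Z := (gact k z.1, gact k z.2).

Lemma diag_act1 z : diag_act 1%g z = z.
Proof. exact: (@prod_act1 K K Z Z z). Qed.

Lemma diag_actM k l z : diag_act (k * l)%g z = diag_act k (diag_act l z).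
Proof. exact: (@prod_actM K K Z Z (k, k) (l, l) z). Qed.

Lemma diag_act_continuous :
  continuous (fun kz : K * (Z * Z) => diag_act kz.1 kz.2).
Proof.
apply: (continuous_comp2
  (f := fun kz : K * (Z * Z) => ((kz.1, kz.1), kz.2))
  (g := fun kz : (K * K) * (Z * Z) => prod_act kz.1 kz.2)); last first.
  exact: prod_act_continuous.
apply: continuous_pair; last exact: continuous_snd.
by apply: continuous_pair; exact: continuous_fst.
Qed.

Definition diag_square : gSpace K :=
  @GSpace K (Z * Z)%type _ diag_act1 diag_actM diag_act_continuous.

End diagonal_square.

Definition unit_interval (R : realType) : topologicalType :=
  set_type [set` `[0 : R, 1]].

Lemma zero_in01 (R : realType) : (0 : R) \in [set` `[0 : R, 1]].
Proof. by apply/mem_set; rewrite /= in_itv /= lexx ler01. Qed.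

Lemma one_in01 (R : realType) : (1 : R) \in [set` `[0 : R, 1]].
Proof. by apply/mem_set; rewrite /= in_itv /= lexx ler01. Qed.

Definition I0 (R : realType) : unit_interval R := exist _ 0 (zero_in01 R).
Definition I1 (R : realType) : unit_interval R := exist _ 1 (one_in01 R).

Section cylinder.
Variables (R : realType) (K : topologicalGroupType) (Z : gSpace K).

Definition cyl_act (k : K) (zt : Z * unit_interval R) : Z * unit_interval R :=
  (gact k zt.1, zt.2).

Lemma cyl_act1 z : cyl_act 1%g z = z.
Proof. by case: z => z t; rewrite /cyl_act gact1. Qed.

Lemma cyl_actM k l z : cyl_act (k * l)%g z = cyl_act k (cyl_act l z).
Proof. by rewrite /cyl_act gactM. Qed.

Lemma cyl_act_continuous :
  continuous (fun kz : K * (Z * unit_interval R) => cyl_act kz.1 kz.2).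
Proof.
apply: continuous_pair; last first.
  exact: (continuous_comp2 (@continuous_snd _ _) (@continuous_snd _ _)).
apply: (continuous_comp2
  (f := fun kz : K * (Z * unit_interval R) => (kz.1, kz.2.1))
  (g := fun kz : K * Z => gact kz.1 kz.2)); last exact: gact_continuous.
apply: continuous_pair; first exact: continuous_fst.
exact: (continuous_comp2 (@continuous_snd _ _) (@continuous_fst _ _)).
Qed.

Definition cylinder : gSpace K :=
  @GSpace K (Z * unit_interval R)%type _ cyl_act1 cyl_actM cyl_act_continuous.

End cylinder.

(* Continuous paths, with the topology induced by the compact-open one. *)
Definition path_space (R : realType) (Z : topologicalType) : Type :=
  continuousType (unit_interval R) Z.

HB.instance Definition _ (R : realType) (Z : topologicalType) :=
  Choice.on (path_space R Z).
HB.instance Definition _ (R : realType) (Z : topologicalType) :=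
  Topological.copy (path_space R Z)
    (@initial_topology (path_space R Z) {compact-open, unit_interval R -> Z}
       (fun gamma => gamma : unit_interval R -> Z)).

Lemma continuous_initial (S T : topologicalType) (U : choiceType) (f : U -> S)
    (g : T -> initial_topology f) :
  continuous (fun x => f (g x) : S) -> continuous g.
Proof.
by move=> cfg; apply/continuousP => _ [B oB <-]; move/continuousP : cfg; apply.
Qed.

Section path_gspace.
Variables (R : realType) (K : topologicalGroupType) (Z : gSpace K).

Lemma path_act_subproof (k : K) (gamma : path_space R Z) :
  continuous (fun t => gact k (gamma t)).
Proof.
apply: (continuous_comp2 (f := fun t => (k, gamma t))
  (g := fun kz : K * Z => gact kz.1 kz.2)); last exact: gact_continuous.
apply: continuous_pair; last exact: cts_fun.
by move=> t; exact: cst_continuous.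
Qed.

Definition path_act (k : K) (gamma : path_space R Z) : path_space R Z :=
  mkcts (@path_act_subproof k gamma).

Lemma path_act1 gamma : path_act 1%g gamma = gamma.
Proof. by apply: (iffRL (continuousEP _ _)) => t; exact: gact1. Qed.

Lemma path_actM k l gamma :
  path_act (k * l)%g gamma = path_act k (path_act l gamma).
Proof. by apply: (iffRL (continuousEP _ _)) => t; exact: gactM. Qed.

Lemma path_act_continuous :
  continuous (fun kg : K * path_space R Z => path_act kg.1 kg.2).
Proof.
apply: continuous_initial => -[k gamma] /=.
apply/compact_open_cvgP => C O cC oO gO.
pose V z := fun N : set K => forall l, N l -> O (gact l z).
have : \forall N \near powerset_filter_from (nbhs k),
    C `<=` (fun t => nbhs ((gamma : path_space R Z) t) [set z | V z N]).
  move/compact_near_coveringP : cC; apply => t Ct.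
  have : nbhs (k, (gamma : path_space R Z) t)
      [set kz : K * Z | O (gact kz.1 kz.2)].
    apply: (@gact_continuous K Z (k, (gamma : path_space R Z) t)).
    by apply: open_nbhs_nbhs; split => //; apply: gO; exists t.
  move=> [[N B] /= [kN tB] NB].
  have tB' : \forall t' \near t, (B°) ((gamma : path_space R Z) t').
    apply: (@cts_fun _ _ (gamma : path_space R Z) t).
    exact: nbhs_interior.
  exists ([set t' | (B°) ((gamma : path_space R Z) t')], [set N' | N' `<=` N]).
    by split => //=; exact: small_set_sub.
  move=> [t' N'] /= [Bt' N'N]; apply: (filterS _ (Bt' : nbhs _ B)) => z Bz l.
  by move=> /N'N Nl; exact: (NB (l, z)).
move=> covN.
have [N [kN CN]] : exists N, nbhs k N /\
    C `<=` (fun t => nbhs ((gamma : path_space R Z) t) [set z | V z N]).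
  exact: filter_ex (filterI (near_small_set _) covN).
exists (N, [set g : path_space R Z |
    (g : unit_interval R -> Z) @` C `<=` [set z | V z N]°]).
  split => //=.
  have oW : open [set g : {compact-open, unit_interval R -> Z} |
      g @` C `<=` [set z | V z N]°].
    by apply: compact_open_open => //; exact: open_interior.
  suff /(@initial_continuous (path_space R Z)
    {compact-open, unit_interval R -> Z}
    (fun gamma => gamma : unit_interval R -> Z) gamma) : nbhs
      (gamma : {compact-open, unit_interval R -> Z})
      [set g : {compact-open, unit_interval R -> Z} |
        g @` C `<=` [set z | V z N]°] by [].
  apply: open_nbhs_nbhs; split => //.
  by move=> _ [t Ct <-]; exact: CN.
move=> [l g] /= [Nl gC] _ [t Ct <-] /=.
have /interior_subset : [set z | V z N]° ((g : path_space R Z) t).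
  by apply: gC; exists t.
by apply.
Qed.

Definition path_gSpace : gSpace K :=
  @GSpace K (path_space R Z) _ path_act1 path_actM path_act_continuous.

Definition path_ends (gamma : path_gSpace) : diag_square Z :=
  ((gamma : path_space R Z) (I0 R), (gamma : path_space R Z) (I1 R)).

End path_gspace.

Definition ghomotopic_on (R : realType) (K : topologicalGroupType)
    (Z W : gSpace K) (U : set Z) (f g : Z -> W) : Prop :=
  exists h : cylinder R Z -> W,
    [/\ gmap_on (U `*` setT : set (cylinder R Z)) h,
        (forall z, U z -> h (z, I0 R) = f z) &
        (forall z, U z -> h (z, I1 R) = g z)].

Definition metrizable (R : realType) (Z : topologicalType) : Prop :=
  exists (M : metricType R) (f : Z -> M) (g : M -> Z),
    [/\ cancel f g, cancel g f, continuous f & continuous g].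

Definition closed_gembedding (K : topologicalGroupType) (Z W : gSpace K)
    (i : Z -> W) : Prop :=
  [/\ gmap i, injective i & forall A, closed A -> closed (i @` A)].

(* A closed invariant subspace is presented by a closed K-embedding i, and the
   retraction of the neighbourhood N onto i(X) by a map with values in W. *)
Definition gANR (R : realType) (K : topologicalGroupType) (X : gSpace K) :
    Prop :=
  metrizable R X /\
  forall (W : gSpace K) (i : X -> W), metrizable R W -> closed_gembedding i ->
    exists (N : set W) (r : W -> W),
      [/\ ginvariant N, range i `<=` N°, gmap_on N r,
          (forall w, N w -> range i (r w)) &
          (forall x, r (i x) = i x)].

Definition gcofibration (R : realType) (K : topologicalGroupType)
    (Z : gSpace K) (A : set Z) : Prop :=
  [/\ closed A, ginvariant A &
    forall (W : gSpace K) (f : Z -> W) (h : cylinder R Z -> W),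
      gmap f -> gmap_on (A `*` setT : set (cylinder R Z)) h ->
      (forall a, A a -> h (a, I0 R) = f a) ->
      exists h' : cylinder R Z -> W,
        [/\ gmap h', (forall z, h' (z, I0 R) = f z) &
            (forall a t, A a -> h' (a, t) = h (a, t))]].

(* [None] is infinity. *)
Definition enat : Type := option nat.

Definition enat_le (x y : enat) : Prop :=
  match x, y with
  | _, None => True
  | Some m, Some n => (m <= n)%N
  | None, Some _ => False
  end.

Definition enat_add (x y : enat) : enat :=
  if (x, y) is (Some m, Some n) then Some (m + n)%N else None.

(* oo - 1 = oo, and 0 - 1 = 0.  The invariants below vanish only on the empty
   space, so truncation matters only for the product of two empty spaces. *)
Definition enat_pred (x : enat) : enat := omap predn x.

Definition enat_least (P : set nat) : enat :=
  if pselect (exists n, `[< P n >]) is left exP then Some (ex_minn exP)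
  else None.

Definition gcover (K : topologicalGroupType) (Z : gSpace K)
    (P : set (set Z)) (n : nat) : Prop :=
  exists U : 'I_n -> set Z,
    (forall i, [/\ open (U i), ginvariant (U i) & P (U i)]) /\
    \bigcup_(i in [set: 'I_n]) U i = [set: Z].

Definition gsection_on (R : realType) (K : topologicalGroupType)
    (Z : gSpace K) (U : set (diag_square Z)) : Prop :=
  exists s : diag_square Z -> path_gSpace R Z,
    gmap_on U s /\ (forall z, U z -> path_ends (s z) = z).

(* TC_K, with K as subscript. *)
Definition equivariant_TC (R : realType) (K : topologicalGroupType) (Z : gSpace K) :
    enat :=
  enat_least (gcover (@gsection_on R K Z)).

Definition gcompressible (R : realType) (K : topologicalGroupType)
    (Z : gSpace K) (A U : set Z) : Prop :=
  exists c : Z -> Z,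
    [/\ gmap_on U c, c @` U `<=` A & ghomotopic_on R U id c].

Definition rel_cat (R : realType) (K : topologicalGroupType) (Z : gSpace K)
    (A : set Z) : enat :=
  enat_least (gcover (gcompressible R A)).

Definition daleth (K : topologicalGroupType) (Z : gSpace K) :
    set (prod_gSpace Z Z) :=
  [set w | exists (k : K * K) (z : Z), w = gact k ((z, z) : prod_gSpace Z Z)].

Arguments daleth {K} Z.

(* TC^K, with K as superscript. *)
Definition invariant_TC (R : realType) (K : topologicalGroupType) (Z : gSpace K) :
    enat :=
  rel_cat R (daleth Z).

(* Main.v *)
Require Import Defs.
From mathcomp Require Import all_boot all_order all_algebra.
From mathcomp Require Import all_classical all_reals all_analysis.
From mathcomp Require Import lra zify.
Import Order.TTheory GRing.Theory Num.Theory.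
Import numFieldNormedType.Exports.

Set Implicit Arguments.
Unset Strict Implicit.
Unset Printing Implicit Defensive.

Local Open Scope classical_set_scope.
Local Open Scope ring_scope.

(* Both invariants count invariant open covers by sets with a property (admitting an
   equivariant motion planner, or an equivariant compression) which passes to
   products, to smaller open invariant sets and to disjoint unions of open
   invariant sets. Over a compact metrizable action every open invariant set is
   the positivity set of an invariant continuous function, so two covers U_i and
   V_j become families f_i and g_j; the points where f_i * g_j strictly dominates
   all products of the same index sum s = i + j form disjoint open sets, and
   uniting them over i + j = s gives a cover indexed by the m + n - 1 values of
   s. *)

(** * Topology of the unit interval and of path spaces *)

Lemma unit_interval_regular (R : realType) : regular_space (unit_interval R).
Proof. exact: (@uniform_regular ([set` `[0 : R, 1]] : Type)). Qed.

Lemma unit_interval_compact (R : realType) : compact [set: unit_interval R].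
Proof.
(* [r] is the identity on the segment, with default value [I0 R] elsewhere; it carries compactness
   of the segment in [R] over to the subtype. *)
pose r : R -> unit_interval R := valL_ (I0 R) id.
have -> : [set: unit_interval R] = r @` [set` `[0, 1]].
  apply/seteqP; split => // t _; exists (\val t); first exact/set_mem/(valP t).
  exact: (congr1 (fun f => f t) (valLK (I0 R) (id : unit_interval R -> _))).
apply: continuous_compact; last exact: segment_compact.
apply: (iffRL (@subspace_valL_continuousP' R _ (unit_interval R) (I0 R) id)) => t; exact: cvg_id.
Qed.

Lemma unit_interval_locally_compact (R : realType) :
  locally_compact [set: unit_interval R].
Proof.
move=> t _; exists setT; first by rewrite withinET; exact: filterT.
by split; [exact: unit_interval_compact | exact: closedT].
Qed.

Section path_pairing.
Variables (R : realType) (X Y : topologicalType).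

(** The interval is locally compact and regular, so evaluation is the continuous uncurrying of the
    map from paths to the compact-open function space. *)
Lemma path_eval_continuous (Z : topologicalType) :
  continuous (fun gt : path_space R Z * unit_interval R => gt.1 gt.2).
Proof.
rewrite (_ : (fun _ => _) = uncurry (fun (g : path_space R Z) t => g t));
  last by apply/funext => -[].
apply: (@continuous_uncurry_regular (path_space R Z) (unit_interval R) Z).
- exact: unit_interval_locally_compact.
- exact: unit_interval_regular.
- exact: initial_continuous.
- by move=> g; exact: cts_fun.
Qed.

Lemma path_pair_subproof (a : path_space R X) (b : path_space R Y) :
  continuous (fun t => (a t, b t)).
Proof. by apply: continuous_pair; exact: cts_fun. Qed.

Definition path_pair (ab : path_space R X * path_space R Y) :
  path_space R (X * Y)%type := mkcts (@path_pair_subproof ab.1 ab.2).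

(** By currying, it suffices that the paired value depends jointly continuously on both paths and
    the time, which evaluation provides. *)
Lemma path_pair_continuous : continuous path_pair.
Proof.
apply: continuous_initial.
apply: (@continuous_curry_fun _ _ _
  (fun abt : (path_space R X * path_space R Y) * unit_interval R =>
     (abt.1.1 abt.2, abt.1.2 abt.2))).
apply: continuous_pair.
- apply: (continuous_comp2 (f := fun abt : (path_space R X * path_space R Y) *
    unit_interval R => (abt.1.1, abt.2))
    (g := fun gt : path_space R X * unit_interval R => gt.1 gt.2)); last exact: path_eval_continuous.
  apply: continuous_pair; last exact: continuous_snd.
  exact: (continuous_comp2 (@continuous_fst _ _) (@continuous_fst _ _)).
- apply: (continuous_comp2 (f := fun abt : (path_space R X * path_space R Y) *
    unit_interval R => (abt.1.2, abt.2))
    (g := fun gt : path_space R Y * unit_interval R => gt.1 gt.2)); last exact: path_eval_continuous.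
  apply: continuous_pair; last exact: continuous_snd.
  exact: (continuous_comp2 (@continuous_fst _ _) (@continuous_snd _ _)).
Qed.

End path_pairing.

(** * Invariant functions with prescribed positivity set *)

Definition has_invariant_bumps (R : realType) (K : topologicalGroupType)
    (T : gSpace K) : Prop :=
  forall U : set T, open U -> ginvariant U ->
  exists f : T -> R, [/\ continuous f, forall k z, f (gact k z) = f z,
    forall z, 0 <= f z & forall z, 0 < f z <-> U z].

(* The supremum is over the radii r at which every translate of z keeps distance
   r from the complement of U; it is invariant by construction, and compactness
   of K makes it positive on U and continuous. *)
Lemma compact_invariant_bumps (R : realType) (K : topologicalGroupType) (T : gSpace K)
    (M : pseudoMetricType R) (e : T -> M) (e' : M -> T) :
  compact [set: K] -> cancel e e' -> continuous e -> continuous e' ->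
  has_invariant_bumps R T.
Proof.
move=> cK eK ce ce' U oU iU.
pose far z r := forall k w, ball (e (gact k z)) r w -> U (e' w).
(* The cap 1 keeps the supremum finite when [U] is the whole space; the guard [0 < r] puts 0 in the
   set even when [z] lies outside [U]. *)
pose S z := [set r : R | 0 <= r <= 1 /\ (0 < r -> far z r)].
pose f z := sup (S z).
have S0 z : S z 0 by split; rewrite ?lexx ?ler01 ?ltxx.
have bS z : has_ubound (S z) by exists 1 => r [/andP[]].
have f0 z : 0 <= f z by apply: ub_le_sup.
have cact : continuous (fun kz : K * T => e (gact kz.1 kz.2)).
  by apply: continuous_comp2 ce; exact: gact_continuous.
exists f; split => //.
- suff lip (z : T) (eps : R) : 0 < eps -> \forall z' \near z, `|f z - f z'| <= eps.
    move=> z; apply/cvgrPdist_le => eps eps0; exact: lip.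
  move=> eps0.
  (* Compactness of [K] makes continuity of the action at the pairs (k, z) uniform in k. *)
  have near_eps : \forall z' \near z, [set: K] `<=` (fun k =>
      ball (e (gact k z)) eps (e (gact k z'))).
    move/compact_near_coveringP: cK; apply => k _.
    have eps20 : 0 < eps / 2 by rewrite divr_gt0.
    have := cact (k, z) _ (nbhsx_ballx (e (gact k z)) _ eps20).
    case=> -[A B] /= [kA zB] AB; exists (A, B) => //= -[k' z'] /= [Ak' Bz'].
    rewrite [eps]splitr; apply: (@ball_triangle _ _ (e (gact k z))).
      by apply: ball_sym; apply: (AB (k', z)); split => //; exact: nbhs_singleton.
    exact: (AB (k', z')).
  (* Triangle inequality: a radius [r > eps] admissible for [x] leaves [r - eps] admissible for
     [y]. *)
  have step x y : (forall k, ball (e (gact k x)) eps (e (gact k y))) ->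
      f x - eps <= f y.
    move=> xy; rewrite lerBlDr; apply: ge_sup; first by exists 0.
    move=> r [/andP[r0 r1] rS]; rewrite -lerBlDr.
    have [re|er] := leP (r - eps) 0; first exact: le_trans re _.
    apply: ub_le_sup => //; split; first by lra.
    move=> _ k w yw; apply: (rS _ k); first lra.
    by rewrite -(subrKC eps r); exact: ball_triangle (xy k) yw.
  apply: filterS near_eps => z' zz'.
  have h1 := step _ _ (fun k => zz' k I).
  have h2 := step _ _ (fun k => ball_sym (zz' k I)).
  by rewrite ler_norml; lra.
- move=> k z; congr sup; apply/seteqP; split => r [r01 rS]; split => // r0 l w.
    by move=> lw; apply: (rS r0 (l * k^-1)%g); rewrite -gactM mulgVK.
  by rewrite -gactM; exact: rS.
- move=> z; split => [fz|Uz].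
    have [r [/andP[r0 _] rS] fr] : exists2 r, S z r & 0 < r.
      apply: contrapT => noS; move: fz; apply/negP; rewrite -leNgt.
      apply: ge_sup; first by exists 0.
      by move=> r Sr; rewrite leNgt; apply/negP => r0; apply: noS; exists r.
    have := rS fr 1%g (e z); rewrite gact1 eK; apply; exact: ballxx.
  (* Each translate of [z] has a ball of some radius [d] that [e'] sends into [U]. Half of [d]
     absorbs moving k, the other half bounds [r], and compactness of [K] yields one radius for all
     translates. *)
  have [r [/andP[r0 r1] rU]] : exists r : R, 0 < r <= 1 /\ far z r.
    have : \forall r \near 0^'+, [set: K] `<=` (fun k =>
        forall w, ball (e (gact k z)) r w -> U (e' w)).
      move/compact_near_coveringP: cK; apply => k _.
      have /nbhs_ballP[d /= d0 dU] : nbhs (e (gact k z)) (e' @^-1` U).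
        by apply: ce'; rewrite eK; apply: open_nbhs_nbhs; split => //; exact: iU.
      have d20 : 0 < d / 2 by rewrite divr_gt0.
      have := cact (k, z) _ (nbhsx_ballx (e (gact k z)) _ d20).
      case=> -[A B] /= [kA zB] AB; exists (A, [set r | r < d / 2]).
        by split => //; exact: nbhs_right_lt.
      move=> [k' r] /= [Ak' rd] w kw; apply: dU; rewrite [d]splitr.
      apply: (ball_triangle (AB (k', z) _)).
        by split => //; exact: nbhs_singleton.
      exact: le_ball (ltW rd) _ kw.
    move=> near_far.
    have : \forall r \near (0 : R)^'+, 0 < r <= 1 /\ far z r.
      near=> r; split; first by apply/andP; split; near: r;
        [exact: nbhs_right_gt | exact: nbhs_right_le].
      move=> k; have : [set: K] `<=` (fun k =>
        forall w, ball (e (gact k z)) r w -> U (e' w)) by near: r.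
      exact.
    by move/filter_ex.
  by apply: (lt_le_trans r0); apply: ub_le_sup => //; split => //; rewrite ltW.
Unshelve. all: by end_near. Qed.

(** * Gluing equivariant maps and combining covers *)

Lemma gmap_on_openP (K : topologicalGroupType) (Z W : gSpace K) (U : set Z)
    (f : Z -> W) : open U ->
  gmap_on U f <-> (forall z, U z -> {for z, continuous f}) /\
                  (forall k z, U z -> f (gact k z) = gact k (f z)).
Proof.
move=> oU; rewrite /gmap_on continuous_open_subspace//.
by split=> -[cf ef]; split => // z; [move=> /mem_set|move=> /set_mem]; exact: cf.
Qed.

(** Disjointness makes the index at a point unambiguous, and openness makes the glued map equal to
    [s i] near each point of [O i]. Outside the union it takes the default value [s0]. *)
Lemma gmap_on_glue (K : topologicalGroupType) (Z W : gSpace K) (I : Type)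
    (O : I -> set Z) (s : I -> Z -> W) (s0 : Z -> W) :
  (forall i, open (O i)) -> (forall i, ginvariant (O i)) ->
  (forall i j z, O i z -> O j z -> i = j) ->
  (forall i, gmap_on (O i) (s i)) ->
  exists s' : Z -> W, gmap_on (\bigcup_i O i) s' /\
    (forall i z, O i z -> s' z = s i z).
Proof.
move=> oO iO dO sO.
pose s' z := if pselect (exists i, O i z) is left ex
  then s (projT1 (cid ex)) z else s0 z.
have s'E i z : O i z -> s' z = s i z.
  rewrite /s'; case: pselect => [ex Oiz|+ Oiz]; last by case; exists i.
  by case: cid => j Ojz /=; rewrite (dO _ _ _ Ojz Oiz).
exists s'; split => //; apply/gmap_on_openP; first exact: bigcup_open.
have sO' i := iffLR (gmap_on_openP (s i) (oO i)) (sO i).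
split => [z [i _ Oiz]|k z [i _ Oiz]]; last first.
  by rewrite (s'E i)// ?(sO' i).2 ?(s'E i)//; exact: iO.
rewrite /prop_for /continuous_at (s'E i)//.
have := (sO' i).1 z Oiz; apply: cvg_trans.
apply: near_eq_cvg.
by near=> y; rewrite (s'E i)//; near: y; exact: open_nbhs_nbhs.
Unshelve. all: by end_near. Qed.

(* A point z lies in the set of index s = i + j for the least i and j at which
   f i z and g j z are positive: every other product of index s vanishes. *)
Lemma gcover_product (R : realType) (K : topologicalGroupType) (T : gSpace K)
    (P : set (set T)) (m n : nat)
    (f : 'I_m -> T -> R) (g : 'I_n -> T -> R) :
  (forall i, [/\ continuous (f i), forall k z, f i (gact k z) = f i z &
     forall z, 0 <= f i z]) ->
  (forall j, [/\ continuous (g j), forall k z, g j (gact k z) = g j z &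
     forall z, 0 <= g j z]) ->
  (forall z, exists i, 0 < f i z) -> (forall z, exists j, 0 < g j z) ->
  (forall O : 'I_m * 'I_n -> set T,
    (forall ij, open (O ij)) -> (forall ij, ginvariant (O ij)) ->
    (forall ij kl z, O ij z -> O kl z -> ij = kl) ->
    (forall ij z, O ij z -> 0 < f ij.1 z /\ 0 < g ij.2 z) ->
    P (\bigcup_ij O ij)) ->
  gcover P (m + n).-1.
Proof.
move=> hf hg f_cov g_cov hP.
pose p (ij : 'I_m * 'I_n) z := f ij.1 z * g ij.2 z.
have p_cont ij : continuous (p ij).
  by move=> z; apply: cvgM; [have [+ _ _] := hf ij.1|have [+ _ _] := hg ij.2];
    exact.
have p_inv ij k z : p ij (gact k z) = p ij z.
  by rewrite /p; have [_ -> _] := hf ij.1; have [_ -> _] := hg ij.2.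
have f_ge0 i z : 0 <= f i z by have [_ _] := hf i.
have g_ge0 j z : 0 <= g j z by have [_ _] := hg j.
(* Positivity is a separate clause because domination is vacuous when [ij] is the only pair with sum
   [s]. *)
pose O s (ij : 'I_m * 'I_n) := [set z | [/\ (ij.1 + ij.2 = s)%N, 0 < p ij z &
  forall kl : 'I_m * 'I_n, (kl.1 + kl.2 = s)%N -> kl != ij ->
    p kl z < p ij z]].
have O_open s ij : open (O s ij).
  rewrite openE => z [ijs p0 dom]; rewrite /interior.
  have near_p0 : \forall y \near z, 0 < p ij y.
    exact: (p_cont ij z _ (lt_nbhsr p0)).
  have near_dom : \forall y \near z, forall kl : 'I_m * 'I_n,
      (kl.1 + kl.2 = s)%N -> kl != ij -> p kl y < p ij y.
    apply: filter_forall => kl.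
    have [kls|kls] := pselect (kl.1 + kl.2 = s)%N; last exact: nearW.
    have [->|klij] := eqVneq kl ij; first exact: nearW.
    have d0 : 0 < p ij z - p kl z by rewrite subr_gt0; exact: dom.
    have near_d : \forall y \near z, 0 < p ij y - p kl y.
      exact: (cvgB (p_cont ij z) (p_cont kl z) (lt_nbhsr d0)).
    by apply: filterS near_d => y; rewrite subr_gt0.
  by apply: filterS2 near_p0 near_dom => y.
have O_inv s ij : ginvariant (O s ij).
  move=> k z [ijs p0 dom]; split; rewrite ?p_inv// => kl.
  by rewrite !p_inv; exact: dom.
have O_disj s ij kl z : O s ij z -> O s kl z -> ij = kl.
  move=> [ijs _ dom_ij] [kls _ dom_kl]; apply/eqP; apply: contrapT => /negP ijkl.
  have := lt_trans (dom_kl ij ijs ijkl) (dom_ij kl kls _).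
  by rewrite eq_sym ltxx => /(_ ijkl).
exists (fun s => \bigcup_ij O s ij); split => [s|].
  split; first exact: bigcup_open.
  - by move=> k z [ij _ Oz]; exists ij => //; exact: O_inv.
  - apply: hP (O_open s) (O_inv s) (@O_disj s) _ => ij z [_ + _].
    by rewrite mulr_ge0_gt0// => /andP[].
apply/seteqP; split => // z _.
have [i0 fi0] := f_cov z; have [j0 gj0] := g_cov z.
case: (@arg_minnP _ i0 (fun i => 0 < f i z) (@nat_of_ord m) fi0) => i fi min_i.
case: (@arg_minnP _ j0 (fun j => 0 < g j z) (@nat_of_ord n) gj0) => j gj min_j.
(* Indices start at 0, so the sums run from 0 to m + n - 2, which is (m + n).-1 values. *)
have ijmn : (i + j < (m + n).-1)%N by have := ltn_ord i; have := ltn_ord j; lia.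
have p0 : 0 < p (i, j) z by rewrite mulr_gt0.
exists (Ordinal ijmn) => //; exists (i, j) => //; split => //= -[k l] /= klij.
rewrite xpair_eqE negb_and => neq.
(* If both factors were positive, minimality would give i <= k and j <= l, and equal sums would
   force (k, l) = (i, j). *)
suff -> : p (k, l) z = 0 by [].
apply/eqP; rewrite mulf_eq0 /=.
have [fk|] := boolP (0 < f k z); last by rewrite lt0r f_ge0 andbT negbK => ->.
have [gl|] := boolP (0 < g l z); last first.
  by rewrite lt0r g_ge0 andbT negbK => ->; rewrite orbT.
have ik := min_i k fk; have jl := min_j l gl.
by move: neq; rewrite -!(inj_eq val_inj) /=; lia.
Qed.

(** The bumps come from the product metric on [M * M]. Keeping [T] apart from [X * X] lets one
    statement serve both the diagonal action and the action of the squared group. *)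
Lemma metrizable_square_bumps (R : realType) (K : topologicalGroupType)
    (T : gSpace K) (X : topologicalType) (h : T -> X * X) (h' : X * X -> T) :
  compact [set: K] -> metrizable R X ->
  cancel h h' -> continuous h -> continuous h' -> has_invariant_bumps R T.
Proof.
move=> cK [M [f [g [fK _ cf cg]]]] hK ch ch'.
pose e z := (f (h z).1, f (h z).2).
pose e' (w : M * M) := h' (g w.1, g w.2).
apply: (@compact_invariant_bumps R K T (M * M)%type e e') => //.
- by move=> z; rewrite /e' /= !fK -surjective_pairing hK.
- apply: continuous_pair; apply: continuous_comp2 cf.
    exact: continuous_comp2 ch (@continuous_fst _ _).
  exact: continuous_comp2 ch (@continuous_snd _ _).
- apply: continuous_comp2 ch'; apply: continuous_pair;
    apply: continuous_comp2 cg; [exact: continuous_fst|exact: continuous_snd].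
Qed.

(** Bumps subordinate to the two covers are pulled back along [p] and [q]; equivariance along [phi]
    and [psi] keeps them invariant. The condition on [S] bundles the passage to products, smaller
    open sets and disjoint unions. *)
Lemma gcover_product_maps (R : realType) (K L1 L2 : topologicalGroupType)
    (T : gSpace K) (Z : gSpace L1) (W : gSpace L2)
    (phi : K -> L1) (psi : K -> L2) (p : T -> Z) (q : T -> W)
    (S : set (set T)) (P : set (set Z)) (Q : set (set W)) (m n : nat) :
  has_invariant_bumps R Z -> has_invariant_bumps R W ->
  continuous p -> continuous q ->
  (forall k z, p (gact k z) = gact (phi k) (p z)) ->
  (forall k z, q (gact k z) = gact (psi k) (q z)) ->
  (forall (I J : Type) (O : I * J -> set T) (U : I -> set Z) (V : J -> set W),
    (forall ij, open (O ij)) -> (forall ij, ginvariant (O ij)) ->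
    (forall ij kl z, O ij z -> O kl z -> ij = kl) ->
    (forall i, open (U i) /\ P (U i)) -> (forall j, open (V j) /\ Q (V j)) ->
    (forall ij z, O ij z -> U ij.1 (p z) /\ V ij.2 (q z)) ->
    S (\bigcup_ij O ij)) ->
  gcover P m -> gcover Q n -> gcover S (m + n).-1.
Proof.
move=> bZ bW cp cq pE qE hS [U [hU covU]] [V [hV covV]].
have [f hf] := choice (fun i => let: And3 oU iU _ := hU i in bZ _ oU iU).
have [g hg] := choice (fun j => let: And3 oV iV _ := hV j in bW _ oV iV).
apply: (@gcover_product R K T S m n (fun i => f i \o p) (fun j => g j \o q)).
- move=> i; have [cf ef f0 _] := hf i; split => [|k z|z] /=; last exact: f0.
    exact: continuous_comp2.
  by rewrite pE ef.
- move=> j; have [cg eg g0 _] := hg j; split => [|k z|z] /=; last exact: g0.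
    exact: continuous_comp2.
  by rewrite qE eg.
- move=> z; have [i _ Ui] : (\bigcup_i U i) (p z) by rewrite covU.
  by exists i; have [_ _ _ /(_ (p z)) [_]] := hf i; exact.
- move=> z; have [j _ Vj] : (\bigcup_j V j) (q z) by rewrite covV.
  by exists j; have [_ _ _ /(_ (q z)) [_]] := hg j; exact.
- move=> O oO iO dO sO; apply: (hS _ _ O U V) => //.
  + by move=> i; have [] := hU i.
  + by move=> j; have [] := hV j.
  + move=> ij z /sO /= [fz gz]; split.
      by have [_ _ _ /(_ (p z)) [+ _]] := hf ij.1; exact.
    by have [_ _ _ /(_ (q z)) [+ _]] := hg ij.2; exact.
Qed.

(** Minimal finite witnesses combine into a witness for [S]; if either value is infinite, so is the
    right-hand side. *)
Lemma enat_least_le (P Q S : set nat) :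
  (forall m n, P m -> Q n -> S (m + n).-1) ->
  enat_le (enat_least S)
    (enat_pred (enat_add (enat_least P) (enat_least Q))).
Proof.
move=> PQS; rewrite /enat_least.
case: (pselect (exists n, `[< P n >])) => [exP|] //; last by case: pselect.
case: (pselect (exists n, `[< Q n >])) => [exQ|] //; last by case: pselect.
case: ex_minnP => m /asboolP Pm _; case: ex_minnP => n /asboolP Qn _.
have Smn := PQS _ _ Pm Qn.
case: pselect => [exS|[]]; last by exists (m + n).-1; apply/asboolP.
by case: ex_minnP => k _ /(_ (m + n).-1); apply; apply/asboolP.
Qed.

(** * Regrouping the square of a product, and motion planners on it *)

Section product_squares.
Variables (G H : topologicalGroupType) (X : gSpace G) (Y : gSpace H).

Definition square_fst (z : (X * Y) * (X * Y)) : X * X := (z.1.1, z.2.1).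
Definition square_snd (z : (X * Y) * (X * Y)) : Y * Y := (z.1.2, z.2.2).
Definition square_pair (w : (X * X) * (Y * Y)) : (X * Y) * (X * Y) :=
  ((w.1.1, w.2.1), (w.1.2, w.2.2)).

Lemma square_fst_continuous : continuous square_fst.
Proof.
apply: continuous_pair; apply: continuous_comp2 (@continuous_fst _ _).
  exact: continuous_fst.
exact: continuous_snd.
Qed.

Lemma square_snd_continuous : continuous square_snd.
Proof.
apply: continuous_pair; apply: continuous_comp2 (@continuous_snd _ _).
  exact: continuous_fst.
exact: continuous_snd.
Qed.

Lemma square_pair_continuous : continuous square_pair.
Proof.
apply: continuous_pair; apply: continuous_pair.
- exact: continuous_comp2 (@continuous_fst _ _) (@continuous_fst _ _).
- exact: continuous_comp2 (@continuous_snd _ _) (@continuous_fst _ _).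
- exact: continuous_comp2 (@continuous_fst _ _) (@continuous_snd _ _).
- exact: continuous_comp2 (@continuous_snd _ _) (@continuous_snd _ _).
Qed.

End product_squares.

(** Motion planners for the factors run side by side: their paths are paired, and the resulting
    local planners are glued over disjoint sets. *)
Lemma equivariant_TC_prod (R : realType) (G H : topologicalGroupType)
    (X : gSpace G) (Y : gSpace H) :
  compact [set: G] -> compact [set: H] -> metrizable R X -> metrizable R Y ->
  enat_le (equivariant_TC R (prod_gSpace X Y))
          (enat_pred (enat_add (equivariant_TC R X) (equivariant_TC R Y))).
Proof.
move=> cG cH mX mY; apply: enat_least_le => m n.
apply: (@gcover_product_maps R _ _ _ (diag_square (prod_gSpace X Y))
  (diag_square X) (diag_square Y) fst snd (@square_fst _ _ X Y)
  (@square_snd _ _ X Y)) => //.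
- by apply: (@metrizable_square_bumps R G (diag_square X) X id id) => // z; exact: cvg_id.
- by apply: (@metrizable_square_bumps R H (diag_square Y) Y id id) => // z; exact: cvg_id.
- exact: square_fst_continuous.
- exact: square_snd_continuous.
move=> I J O U V oO iO dO hU hV OUV.
have [s hs] := choice (fun i => (hU i).2).
have [t ht] := choice (fun j => (hV j).2).
(* Constant paths provide the default value of the glued section outside the union. *)
have cst_cont (w : X * Y) : continuous (fun _ : unit_interval R => w).
  by move=> a; exact: cst_continuous.
pose st ij (z : diag_square (prod_gSpace X Y)) : path_gSpace R (prod_gSpace X Y) :=
  path_pair (s ij.1 (square_fst z) : path_space R X,
             t ij.2 (square_snd z) : path_space R Y).
have [|r [rO rE]] := @gmap_on_glue _ _ (path_gSpace R (prod_gSpace X Y)) _ O st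
    (fun z => mkcts (cst_cont z.1)) oO iO dO.
  move=> [i j]; apply/gmap_on_openP => //; split => [z|k z] /OUV /= [Uz Vz].
    have [/(gmap_on_openP _ (hU i).1)[cs _] _] := hs i.
    have [/(gmap_on_openP _ (hV j).1)[ct _] _] := ht j.
    apply: continuous_comp; last exact: path_pair_continuous.
    apply: cvg_fun_pair; apply: continuous_comp.
    + exact: square_fst_continuous.
    + exact: cs.
    + exact: square_snd_continuous.
    + exact: ct.
  have [[_ es] _] := hs i; have [[_ et] _] := ht j.
  apply: (iffRL (continuousEP _ _)) => a /=; rewrite /st /=.
  by rewrite (es k.1 (square_fst z) Uz) (et k.2 (square_snd z) Vz).
exists r; split => // z [[i j] _ Oz]; rewrite (rE _ _ Oz).
have [Uz Vz] := OUV _ _ Oz.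
have [_ /(_ _ Uz) es] := hs i; have [_ /(_ _ Vz) et] := ht j.
case: z Oz Uz Vz es et => -[x y] [x' y'] _ _ _ [s0 s1] [t0 t1].
by congr ((_, _), (_, _)).
Qed.

(** * Homotopies on cylinders and compression into the saturated diagonal *)

Lemma open_cylinder (R : realType) (K : topologicalGroupType) (Z : gSpace K)
    (U : set Z) :
  open U -> open (U `*` setT : set (cylinder R Z)).
Proof.
move=> oU; rewrite (_ : _ `*` _ = (fst : cylinder R Z -> Z) @^-1` U).
  by apply: open_comp => // z _; exact: continuous_fst.
by apply/seteqP; split => -[z a] // [].
Qed.

(** The compression is the end of the homotopy, so only the homotopy has to be glued. *)
Lemma gcompressible_homotopy (R : realType) (K : topologicalGroupType)
    (Z : gSpace K) (A U : set Z) (h : cylinder R Z -> Z) :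
  open U -> ginvariant U -> gmap_on (U `*` setT : set (cylinder R Z)) h ->
  (forall z, U z -> h (z, I0 R) = z) -> (forall z, U z -> A (h (z, I1 R))) ->
  gcompressible R A U.
Proof.
move=> oU iU hU h0 h1; exists (fun z => h (z, I1 R)); split.
- have oUT : open (U `*` setT : set (cylinder R Z)).
    exact: open_cylinder.
  have [ch eh] := iffLR (gmap_on_openP h oUT) hU.
  apply/gmap_on_openP => //; split => [z Uz|k z Uz]; last exact: (eh k (z, _)).
  apply: (@continuous_comp _ (cylinder R Z) _ (fun z => (z, I1 R)) h).
    by apply: cvg_fun_pair; [exact: cvg_id|exact: cst_continuous].
  exact: ch.
- by move=> _ [z Uz <-]; exact: h1.
- by exists h.
Qed.

Lemma invariant_TC_prod (R : realType) (G H : topologicalGroupType)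
    (X : gSpace G) (Y : gSpace H) :
  compact [set: G] -> compact [set: H] -> metrizable R X -> metrizable R Y ->
  enat_le (invariant_TC R (prod_gSpace X Y))
          (enat_pred (enat_add (invariant_TC R X) (invariant_TC R Y))).
Proof.
move=> cG cH mX mY; apply: enat_least_le => m n.
have cGG : compact [set: (G * G)%type] by rewrite -setXTT; exact: compact_setX.
have cHH : compact [set: (H * H)%type] by rewrite -setXTT; exact: compact_setX.
set T := prod_gSpace (prod_gSpace X Y) (prod_gSpace X Y).
(* The two group maps regroup the square of [G * H] into the squares of [G] and [H]. *)
apply: (@gcover_product_maps R _ _ _ T
  (prod_gSpace X X) (prod_gSpace Y Y)
  (fun k => (k.1.1, k.2.1)) (fun k => (k.1.2, k.2.2))
  (@square_fst _ _ X Y) (@square_snd _ _ X Y)) => //.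
- by apply: (@metrizable_square_bumps R _ (prod_gSpace X X) X id id) => // z; exact: cvg_id.
- by apply: (@metrizable_square_bumps R _ (prod_gSpace Y Y) Y id id) => // z; exact: cvg_id.
- exact: square_fst_continuous.
- exact: square_snd_continuous.
move=> I J O U V oO iO dO hU hV OUV.
have [c hc] := choice (fun i => (hU i).2).
have [d hd] := choice (fun j => (hV j).2).
have [s hs] := choice (fun i => let: And3 _ _ hom := hc i in hom).
have [t ht] := choice (fun j => let: And3 _ _ hom := hd j in hom).
(* The two compressing homotopies run simultaneously, with a common time parameter. *)
pose st ij (za : cylinder R T) : T :=
  square_pair (s ij.1 (square_fst za.1, za.2), t ij.2 (square_snd za.1, za.2)).
pose OI ij : set (cylinder R T) := O ij `*` setT.
have oOI ij : open (OI ij) by exact: open_cylinder.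
have iOI ij : ginvariant (OI ij) by move=> k z [Oz _]; split => //; exact: iO.
have dOI ij kl z : OI ij z -> OI kl z -> ij = kl.
  by move=> [Oz _] [Oz' _]; exact: dO Oz Oz'.
have [|h [hO hE]] := @gmap_on_glue _ _ T _ OI st fst oOI iOI dOI.
  move=> [i j]; have [hs' _ _] := hs i; have [ht' _ _] := ht j.
  have oUI : open (U i `*` setT : set (cylinder R (prod_gSpace X X))).
    exact/open_cylinder/(hU i).1.
  have oVI : open (V j `*` setT : set (cylinder R (prod_gSpace Y Y))).
    exact/open_cylinder/(hV j).1.
  have [cs es] := iffLR (gmap_on_openP _ oUI) hs'.
  have [ct et] := iffLR (gmap_on_openP _ oVI) ht'.
  apply/gmap_on_openP => //; split => [[z a] [Oz _]|k [z a] [Oz _]];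
    have [Uz Vz] := OUV _ _ Oz.
    apply: continuous_comp; last exact: square_pair_continuous.
    apply: cvg_fun_pair.
      apply: (@continuous_comp _ (cylinder R (prod_gSpace X X)) _
        (fun za : cylinder R T => (square_fst za.1, za.2)) (s i)).
        apply: continuous_pair; last exact: continuous_snd.
        exact: continuous_comp2 (@continuous_fst _ _)
          (@square_fst_continuous _ _ _ _).
      exact: cs.
    apply: (@continuous_comp _ (cylinder R (prod_gSpace Y Y)) _
      (fun za : cylinder R T => (square_snd za.1, za.2)) (t j)).
      apply: continuous_pair; last exact: continuous_snd.
      exact: continuous_comp2 (@continuous_fst _ _)
        (@square_snd_continuous _ _ _ _).
    exact: ct.
  have := es (k.1.1, k.2.1) (square_fst z, a) (conj Uz Logic.I).
  have := et (k.1.2, k.2.2) (square_snd z, a) (conj Vz Logic.I).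
  by rewrite /st /= => -> ->.
(* The glued homotopy lives on the union of the cylinders, which is the cylinder over the union. *)
have OIE : (\bigcup_ij O ij) `*` setT = \bigcup_ij OI ij.
  apply/seteqP; split => [[z a] [[ij _ Oz] _]|[z a] [ij _ [Oz _]]].
    by exists ij.
  by split => //; exists ij.
apply: (gcompressible_homotopy (h := h)).
- exact: bigcup_open.
- by move=> k z [ij _ Oz]; exists ij => //; exact: iO.
- by rewrite OIE.
- move=> z [[i j] _ Oz]; have [Uz Vz] := OUV _ _ Oz.
  rewrite (hE (i, j)) // /st /=.
  have [_ -> // _] := hs i; have [_ -> // _] := ht j.
  by case: z {Oz Uz Vz} => -[x y] [x' y'].
- move=> z [[i j] _ Oz]; have [Uz Vz] := OUV _ _ Oz.
  rewrite (hE (i, j)) // /st /=.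
  have [_ _ -> //] := hs i; have [_ _ -> //] := ht j.
  have [_ cA _] := hc i; have [_ dA _] := hd j.
  have [[k1 k2] [x ->]] := cA _ (imageP _ Uz).
  have [[l1 l2] [y ->]] := dA _ (imageP _ Vz).
  (* The translates of (x, x) by (k1, k2) and of (y, y) by (l1, l2) regroup to a translate of the
     diagonal point over (x, y). *)
  by exists ((k1, l1), (k2, l2)), (x, y).
Qed.

Theorem theorem3p18 (R : realType) (G H : topologicalGroupType)
  (hG : compact_lie_group R G) (hH : compact_lie_group R H)
  (X : gSpace G) (Y : gSpace H)
  (cX : compact [set: X]%classic) (cY : compact [set: Y]%classic)
  (aX : gANR R X) (aY : gANR R Y) :
  enat_le (equivariant_TC R (prod_gSpace X Y))
          (enat_pred (enat_add (equivariant_TC R X) (equivariant_TC R Y)))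
  /\
  (gcofibration R (daleth X) -> gcofibration R (daleth Y) ->
   enat_le (invariant_TC R (prod_gSpace X Y))
           (enat_pred (enat_add (invariant_TC R X) (invariant_TC R Y)))).
Proof.
(* The group hypotheses supply compactness, the ANR hypotheses supply metrizability. *)
case: hG hH aX aY => [_ cG] [_ cH] [mX _] [mY _].
by split => [|_ _]; [exact: equivariant_TC_prod|exact: invariant_TC_prod].
Qed.
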